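(* Let $C$ be a conjugation on $\mathcal{K}$ and let $S\in\mathcal{B}(\mathcal{K})$. Then $S$ is $2$-$C$-normal if and only if $$CSS^{*}CS^{*}=S^{*}CS^{*}SC.$$
   Context: $\mathcal{K}$ is a nontrivial separable complex Hilbert space and $\mathcal{B}(\mathcal{K})$ is the algebra of bounded linear operators on $\mathcal{K}$. A conjugation on $\mathcal{K}$ is an antilinear map $C:\mathcal{K}\to\mathcal{K}$ with $C^{2}=I$ and $\langle Cx,Cy\rangle=\langle y,x\rangle$ for all $x,y\in\mathcal{K}$. For a bounded antilinear operator $X$ on $\mathcal{K}$, $X^{\#}$ denotes its antilinear adjoint: the unique bounded antilinear operator with $\langle Xx,y\rangle=\overline{\langle x,X^{\#}y\rangle}$ for all $x,y\in\mathcal{K}$; in particular $(SC)^{\#}=CS^{*}$ for $S\in\mathcal{B}(\mathcal{K})$. An operator $S\in\mathcal{B}(\mathcal{K})$ is $2$-$C$-normal if $(SC)^{2}(SC)^{\#}=(SC)^{\#}(SC)^{2}$. *)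

(* Defs.v *)
From HB Require Import structures.
From mathcomp Require Import all_boot all_order all_algebra sesquilinear.
From mathcomp Require Import complex.
From mathcomp Require Import all_classical all_reals all_analysis.

Set Implicit Arguments.
Unset Strict Implicit.
Unset Printing Implicit Defensive.

Import Order.TTheory GRing.Theory Num.Theory.
Import numFieldNormedType.Exports.

Local Open Scope classical_set_scope.
Local Open Scope ring_scope.
Local Open Scope complex_scope.

(* The inner product is linear in its first argument and conjugate-linear in
   its second one, as for every [{dot _ for Num.conj}]. *)
HB.mixin Record CompleteNormedModule_isHilbert (R : realType) (V : Type)
    & CompleteNormedModule R[i] V := {
  inner : {dot V for Num.conj} ;
  sqr_norm_inner : forall x : V, `|x| ^+ 2 = inner x x
}.

#[short(type="hilbertType")]
HB.structure Definition Hilbert (R : realType) :=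
  {V of CompleteNormedModule R[i] V & CompleteNormedModule_isHilbert R V}.

Definition separable (T : topologicalType) : Prop :=
  exists2 D : set T, countable D & dense D.

Section operators.
Variables (R : realType) (K : hilbertType R).
Implicit Types S T X Y C : K -> K.

Definition antilinear X : Prop :=
  GRing.linear_for ((Num.conj : R[i] -> R[i]) \; *:%R) X.

Definition bounded_operator X : Prop :=
  exists M : R[i], forall x, `|X x| <= M * `|x|.

Definition bounded_linear S : Prop := linear S /\ bounded_operator S.

Definition bounded_antilinear X : Prop := antilinear X /\ bounded_operator X.

Definition is_adjoint S T : Prop :=
  bounded_linear T /\ forall x y, inner (S x) y = inner x (T y).

(* By Riesz's theorem a bounded linear operator has exactly one adjoint; the
   default value [0] is only there to make the definition total. *)
Definition adjoint S : K -> K := xget (fun=> 0) (is_adjoint S).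

Definition is_antilinear_adjoint X Y : Prop :=
  bounded_antilinear Y /\
  forall x y, inner (X x) y = (Num.conj (inner x (Y y)) : R[i]).

(* Same remark, for bounded antilinear operators. *)
Definition antilinear_adjoint X : K -> K :=
  xget (fun=> 0) (is_antilinear_adjoint X).

Definition conjugation C : Prop :=
  [/\ antilinear C, C \o C = id
    & forall x y, inner (C x) (C y) = inner y x].

Definition two_C_normal C S : Prop :=
  let X := S \o C in
  X \o X \o antilinear_adjoint X = antilinear_adjoint X \o (X \o X).

End operators.

(* Main.v *)
Require Import Defs.
From HB Require Import structures.
From mathcomp Require Import all_boot all_order all_algebra sesquilinear.
From mathcomp Require Import complex.
From mathcomp Require Import all_classical all_reals all_analysis.

Import Order.TTheory GRing.Theory Num.Theory.
Import numFieldNormedType.Exports.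

Local Open Scope classical_set_scope.
Local Open Scope ring_scope.

(** Put [X = S \o C]. Then the antilinear adjoint of [X] is [C \o adjoint S]
    ([antilinear_adjoint_comp]), and since $C^2=I$, 2-C-normality reads $SCSS^*=CS^*SCSC$. Taking
    antilinear adjoints of both sides reverses the products and gives $SS^*CS^*=CS^*CS^*SC$;
    multiplying by $C$ on the left yields the stated identity. Both operations are invertible, so
    the argument runs in either direction. *)

Lemma inner_conj (R : realType) (K : hilbertType R) (x y : K) :
  inner x y = Num.conj (inner y x) :> R[i]%C.
Proof. by rewrite (@hermC _ _ _ _ (@inner R K)) expr0 mul1r. Qed.

Lemma inner_inj (R : realType) (K : hilbertType R) (u v : K) :
  (forall w : K, inner u w = inner v w :> R[i]%C) -> u = v.
Proof.
move=> uv; apply/eqP; rewrite -subr_eq0 -normr_eq0 -sqrf_eq0 sqr_norm_inner.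
by rewrite linearBl /= uv subrr.
Qed.

Section conjugation_theory.
Context {R : realType} {K : hilbertType R} {C : K -> K}.
Hypothesis C_conj : conjugation C.

Lemma conjugationK : involutive C.
Proof. by case: C_conj => _ CC _ x; exact: (congr1 (@^~ x) CC). Qed.

(** This makes [C] its own antilinear adjoint: write [y] as [C (C y)] and use the isometry
    identity. *)
Lemma inner_conjugationl x y : inner (C x) y = inner (C y) x :> R[i]%C.
Proof. by case: C_conj => _ _ CI; rewrite -{1}[y]conjugationK CI. Qed.

Lemma antilinear_comp_conjugation (X : K -> K) :
  antilinear X -> linear (C \o X).
Proof.
case: C_conj => CL _ _ XL a x y /=.
by rewrite XL /= CL /= conjCK.
Qed.

Lemma linear_comp_conjugation (X : K -> K) :
  linear X -> antilinear (C \o X).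
Proof. by case: C_conj => CL _ _ XL a x y /=; rewrite XL CL. Qed.

Lemma conjugation0 : C 0 = 0.
Proof.
case: C_conj => CL _ _; have := CL (-1) 0 0.
by rewrite scaler0 addr0 /= rmorphN1 scaleN1r addNr.
Qed.

Lemma norm_conjugation x : `|C x| = `|x|.
Proof.
case: C_conj => _ _ CI; apply/eqP.
by rewrite -(@eqrXn2 _ 2)// !sqr_norm_inner CI.
Qed.

Lemma bounded_comp_conjugation (X : K -> K) :
  bounded_operator X -> bounded_operator (C \o X).
Proof. by case=> M XM; exists M => x /=; rewrite norm_conjugation. Qed.

Lemma is_antilinear_adjoint_comp (S T : K -> K) :
  is_adjoint S T -> is_antilinear_adjoint (S \o C) (C \o T).
Proof.
move=> [[TL TB] ST]; split; first split.
- exact: linear_comp_conjugation.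
- exact: bounded_comp_conjugation.
- by move=> x y /=; rewrite ST inner_conjugationl inner_conj.
Qed.

(** Converse of [is_antilinear_adjoint_comp], by evaluating at [C x]: [S] has an adjoint exactly
    when [S \o C] has an antilinear one. *)
Lemma is_adjoint_comp (S Y : K -> K) :
  is_antilinear_adjoint (S \o C) Y -> is_adjoint S (C \o Y).
Proof.
move=> [[YL YB] SY]; split; first split.
- exact: antilinear_comp_conjugation.
- exact: bounded_comp_conjugation.
- move=> x y /=; have := SY (C x) y; rewrite /= conjugationK => ->.
  by rewrite inner_conjugationl -!inner_conj.
Qed.

Lemma antilinear_adjoint_unique (X Y Z : K -> K) :
  is_antilinear_adjoint X Y -> is_antilinear_adjoint X Z -> Y = Z.
Proof.
move=> [_ XY] [_ XZ]; apply/funext => y; apply: inner_inj => w.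
by rewrite inner_conj -XY XZ -inner_conj.
Qed.

(* When [S] has no adjoint, both sides are the default value [0], so Riesz's
   theorem is not needed. *)
Lemma antilinear_adjoint_comp (S : K -> K) :
  antilinear_adjoint (S \o C) = C \o adjoint S.
Proof.
rewrite /adjoint; case: xgetP => [T _ ST|noT].
  apply: xget_unique; first exact: is_antilinear_adjoint_comp.
  by move=> Y SY; apply: antilinear_adjoint_unique SY _;
     exact: is_antilinear_adjoint_comp.
rewrite /antilinear_adjoint; case: xgetP => [Y _ /is_adjoint_comp/noT//|_].
by apply/funext => x /=; rewrite conjugation0.
Qed.

End conjugation_theory.

Theorem theorem2p9 (R : realType) (K : hilbertType R)
    (K_nontrivial : exists x : K, x != 0) (K_separable : separable K)
    (C : K -> K) (C_conj : conjugation C)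
    (S : K -> K) (S_bounded : bounded_linear S) :
  two_C_normal C S <->
  C \o S \o adjoint S \o C \o adjoint S =
  adjoint S \o C \o adjoint S \o S \o C.
Proof.
have CK := conjugationK C_conj; have C0 := conjugation0 C_conj.
have CI := inner_conjugationl C_conj.
rewrite /two_C_normal (antilinear_adjoint_comp C_conj).
rewrite /adjoint; case: xgetP => [T _ [_ ST]|_]; last first.
  (* Here [adjoint S] is the default zero map; as [C] and [S] fix 0, both equations say 0 = 0. *)
  have S0 : S 0 = 0.
    by case: S_bounded => SL _; have := SL (-1) 0 0;
       rewrite scaler0 addr0 scaleN1r addNr.
  by split=> _; apply/funext => x /=; rewrite !(C0, S0).
have TS x y : inner (T x) y = inner x (S y) :> R[i]%C.
  by rewrite inner_conj -ST -inner_conj.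
have CI' x y : inner x (C y) = inner y (C x) :> R[i]%C.
  by rewrite inner_conj CI -inner_conj.
(* The two sides of the identity, composed with [C] on the left, are the antilinear
   adjoints of the two sides of 2-C-normality. *)
have adjL x y : inner (S (C (S (T x)))) y = inner (S (T (C (T y)))) x :> R[i]%C.
  by rewrite ST CI -TS -ST.
have adjR x y : inner (C (T (S (C (S (C x)))))) y =
    inner (C (T (C (T (S (C y)))))) x :> R[i]%C.
  by rewrite CI -ST -TS CI' ST CI.
split=> E; apply/funext => x /=.
  (* Once the leading [C] is cancelled, pairing with [w] turns the goal at [x] into 2-C-normality at
     [w], paired with [x]. *)
  rewrite -[RHS]CK; congr C; apply: inner_inj => w; rewrite -adjL -adjR.
  by have /= <- := congr1 (@^~ w) E; rewrite CK.
rewrite CK; apply: inner_inj => w; rewrite adjL adjR.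
by have /= <- := congr1 (@^~ w) E; rewrite CK.
Qed.
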